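(* Let $n=2$, let $A=(a_{kj})$ be a real $2\times 2$ matrix whose entries do not depend on $x=(x_1,x_2)^T\in\mathbb{R}^2$, and let $y=Ax$, i.e. $y_k=\sum_{j=1}^{2}a_{kj}x_j$ for $k=1,2$. Then for every $k\in\{1,2\}$ and $i\in\{1,2\}$, $$\int y_k\,dx_i=\begin{cases} x_1\displaystyle\sum_{j=1}^{2}\frac{j}{n}\,a_{kj}x_j, & i=1,\\[2mm] x_2\displaystyle\sum_{j=1}^{2}\frac{1}{j}\,a_{kj}x_j, & i=2.\end{cases}$$
   Context: For a polynomial $p$ in the real variables $x_1,x_2$, $\int p\,dx_i$ denotes the antiderivative of $p$ with respect to $x_i$, the other variable being held constant, with the constant of integration omitted; that is, the polynomial $P$ with $\partial P/\partial x_i=p$ and $P=0$ when $x_i=0$. *)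

(* Defs.v *)
From mathcomp Require Export all_boot all_order all_algebra.
From mathcomp Require Export reals.
From mathcomp Require Export mpoly.

Set Implicit Arguments.
Unset Strict Implicit.
Unset Printing Implicit Defensive.

Import GRing.Theory Num.Theory.
Local Open Scope ring_scope.

(* Substitution of 0 for the variable of index [i]. *)
Definition msubst0 (n : nat) (R : realType) (i : 'I_n) (P : {mpoly R[n]}) :
  {mpoly R[n]} :=
  P \mPo [tuple if j == i then 0 else 'X_j | j < n].

Definition is_antideriv (n : nat) (R : realType) (i : 'I_n)
  (p P : {mpoly R[n]}) : Prop :=
  P^`M(i) = p /\ msubst0 i P = 0.

(* [antiderivP] below shows that this is the unique [P] such that
   [is_antideriv i p P]. *)
Definition antideriv (n : nat) (R : realType) (i : 'I_n) (p : {mpoly R[n]}) :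
  {mpoly R[n]} :=
  \sum_(m <- msupp p) (p@_m / (m i).+1%:R) *: 'X_[m + U_(i)].

Lemma msubst0X (n : nat) (R : realType) (i : 'I_n) (m : 'X_{1..n}) :
  msubst0 i ('X_[m] : {mpoly R[n]}) = if m i == 0%N then 'X_[m] else 0.
Proof.
rewrite /msubst0 comp_mpolyX; case: eqP => [mi0|/eqP mi].
  rewrite -[RHS]mmap1_id /mmap1; apply: eq_bigr => j _; rewrite tnth_mktuple.
  by case: eqP => // ->; rewrite mi0 !expr0.
by rewrite (bigD1 i) //= tnth_mktuple eqxx expr0n (negPf mi) mul0r.
Qed.

Lemma mcoeff_msubst0 (n : nat) (R : realType) (i : 'I_n) (P : {mpoly R[n]})
  (m : 'X_{1..n}) : m i = 0%N -> (msubst0 i P)@_m = P@_m.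
Proof.
move=> mi0; rewrite {2}[P]mpolyE /msubst0 comp_mpolyEX !raddf_sum /=.
apply: eq_bigr => m' _; rewrite !mcoeffZ; congr (_ * _).
rewrite -/(msubst0 i _) msubst0X; case: ifP => // m'i.
rewrite mcoeff0 mcoeffX; case: eqP => // e.
by rewrite e mi0 eqxx in m'i.
Qed.

Lemma is_antideriv_inj (n : nat) (R : realType) (i : 'I_n)
  (p P Q : {mpoly R[n]}) :
  is_antideriv i p P -> is_antideriv i p Q -> P = Q.
Proof.
case=> dP P0 [dQ Q0]; apply/mpolyP => m.
have [mi0|mi] := eqVneq (m i) 0%N.
  by rewrite -(mcoeff_msubst0 P mi0) -(mcoeff_msubst0 Q mi0) P0 Q0.
have -> : m = (m - U_(i) + U_(i))%MM.
  by rewrite submK // lep1mP.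
have := congr1 (mcoeff (m - U_(i))%MM) (etrans dP (esym dQ)).
rewrite !mcoeff_mderiv -[LHS]mulr_natr -[RHS]mulr_natr; apply: mulIf.
by rewrite pnatr_eq0.
Qed.

Lemma antideriv_is_antideriv (n : nat) (R : realType) (i : 'I_n)
  (p : {mpoly R[n]}) : is_antideriv i p (antideriv i p).
Proof.
split; rewrite /antideriv.
  rewrite [RHS]mpolyE raddf_sum /=; apply: eq_bigr => m _.
  rewrite mderivZ mderivX mnmDE mnm1E eqxx addn1 addmK scalerA divfK //.
  by rewrite pnatr_eq0.
rewrite /msubst0 raddf_sum /= big1 // => m _.
by rewrite comp_mpolyZ -/(msubst0 i _) msubst0X mnmDE mnm1E eqxx addn1 scaler0.
Qed.

Lemma antiderivP (n : nat) (R : realType) (i : 'I_n) (p P : {mpoly R[n]}) :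
  is_antideriv i p P <-> P = antideriv i p.
Proof.
split=> [aP|->]; last exact: antideriv_is_antideriv.
exact: is_antideriv_inj aP (antideriv_is_antideriv i p).
Qed.

(* Main.v *)
Require Import Defs.
From mathcomp Require Import all_boot all_order all_algebra reals mpoly.
Import GRing.Theory Num.Theory.
Local Open Scope ring_scope.

(** Integration in [x_i] multiplies a linear form by [x_i] and halves the
    coefficient of [x_i] itself, every other variable being a constant
    ([is_antideriv_linear], valid in any number of variables).  For two
    variables, the weights [j / 2] and [1 / j] of the theorem are merely closed
    forms for this halving: [j / 2] is [1/2, 1], which halves at [j = 1], and
    [1 / j] is [1, 1/2], which halves at [j = 2].  The antiderivative being
    unique, checking this product is enough. *)

Lemma mderivU (n : nat) (R : realType) (i j : 'I_n) :
  ('X_j : {mpoly R[n]})^`M(i) = (j == i)%:R.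
Proof.
rewrite mderivX mnm1E; case: eqP => [->|_]; last by rewrite scale0r.
by rewrite scale1r -[X in (X - _)%MM]add0m addmK mpolyX0.
Qed.

(** The halving comes from the product rule: besides [\sum_j w_j c_j x_j],
    with weight [w_i = 1/2] and the others [1], it produces [x_i] times the
    coefficient [c_i / 2], which restores the missing half of [c_i x_i]. *)
Lemma is_antideriv_linear (n : nat) (R : realType) (i : 'I_n)
  (c : 'I_n -> R) :
  is_antideriv i (\sum_(j < n) c j *: 'X_j)
    ('X_i * \sum_(j < n) ((if j == i then 2%:R^-1 else 1) * c j) *: 'X_j).
Proof.
split; last first.
  by rewrite /msubst0 rmorphM /= comp_mpolyXU -tnth_nth tnth_mktuple eqxx mul0r.
rewrite mderivM mderivU eqxx mul1r raddf_sum /=.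
rewrite (bigD1 i) //= [X in _ + _ * X](bigD1 i) //= eqxx.
rewrite [X in _ + _ * (_ + X)]big1 => [|j ji]; last first.
  by rewrite mderivZ mderivU (negPf ji) scaler0.
rewrite [RHS](bigD1 i) //= mderivZ mderivU eqxx addr0 -scalerAr mulr1.
rewrite addrAC -scalerDl -mulrDl.
have -> : 2%:R^-1 + 2%:R^-1 = 1 :> R.
  by rewrite -mulr2n -[LHS]mulr_natr mulVf // pnatr_eq0.
rewrite mul1r; congr (_ + _); apply: eq_bigr => j /negPf ->.
by rewrite mul1r.
Qed.

(* 'X_0, 'X_1 stand for x_1, x_2; the summation index j : 'I_2 is 0-based,
   so the coefficient j becomes j.+1; 2%:R is n. *)
Theorem theorem4p2 (R : realType) (A : 'M[R]_2) (x y : 'cV[{mpoly R[2]}]_2)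
  (hx : x = \col_(j < 2) 'X_j)
  (hy : y = map_mx (@mpolyC 2 R) A *m x)
  (k i : 'I_2) :
  antideriv i (y k 0) =
    if i == 0 then x 0 0 * \sum_(j < 2) ((j.+1)%:R / 2%:R * A k j) *: x j 0
    else x 1 0 * \sum_(j < 2) ((j.+1)%:R^-1 * A k j) *: x j 0.
Proof.
have -> : y k 0 = \sum_(j < 2) A k j *: 'X_j.
  rewrite hy mxE; apply: eq_bigr => j _.
  by rewrite hx !mxE mul_mpolyC.
have /antiderivP <- := is_antideriv_linear _ _ i (A k).
have n2 : 2%:R != 0 :> R by rewrite pnatr_eq0.
have [->|i0] := eqVneq i 0.
  rewrite hx mxE; congr (_ * _); apply: eq_bigr => j _; rewrite mxE.
  congr ((_ * _) *: _).
  by case: j => [[|[|//]] //= _]; rewrite ?div1r ?divff.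
have -> : i = 1 by apply/val_inj; case: i i0 => [[|[|]]].
rewrite hx mxE; congr (_ * _); apply: eq_bigr => j _; rewrite mxE.
congr ((_ * _) *: _).
by case: j => [[|[|//]] //= _]; rewrite ?invr1.
Qed.
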